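(* (Star junction model.) Consider a star junction of $n$ pipes $P_1,\dots,P_n$ connecting to $m$ pipes $P_{n+1},\dots,P_{n+m}$, under the modeling assumptions listed in the context, with individual pipe dynamics $$\dot p_{j,r}=\alpha_j(q_{j,r}-q_{j,\ell}),\qquad \dot q_{j,\ell}=\beta_j p_{j,r}+\kappa_j p_{j,\ell}+\gamma_j q_{j,\ell},\qquad j=1,\dots,n+m,$$ and matching conditions at the junction $$p_{1,r}=\dots=p_{n,r}=p_{n+1,\ell}=\dots=p_{n+m,\ell},\qquad q_{1,r}+\dots+q_{n,r}=q_{n+1,\ell}+\dots+q_{n+m,\ell}.$$ Then the star junction can be represented by the state-space model consisting of the four systems $$\dot x_1=A_1x_1+B_1u,\qquad \dot x_2=A_2x_2+B_2u,\qquad \dot x_3=A_3x_3+B_3u,\qquad \dot x_4=A_4x_4+B_4u,$$ $$y=C(x_1+x_2+x_3+x_4),$$ where $$x_1=x_2=x_3=x_4=\begin{bmatrix}p_{1,r}&p_{n+1,r}&p_{n+2,r}&\dots&p_{n+m,r}&q_{1,\ell}&q_{2,\ell}&\dots&q_{n+m,\ell}\end{bmatrix}^\top\in\mathbb R^{n+2m+1},$$ $$u=\begin{bmatrix}p_{1,\ell}&p_{2,\ell}&\dots&p_{n,\ell}&q_{n+1,r}&q_{n+2,r}&\dots&q_{n+m,r}\end{bmatrix}^\top\in\mathbb R^{n+m},$$ $$y=\begin{bmatrix}p_{n+1,r}&p_{n+2,r}&\dots&p_{n+m,r}&q_{1,\ell}&q_{2,\ell}&\dots&q_{n,\ell}\end{bmatrix}^\top\in\mathbb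 R^{n+m},$$ and the matrices are $$A_1=\begin{bmatrix}\begin{matrix}\mathbf 0_{m+1}&-a&-a\mathbf 1_{n-1}&a\mathbf 1_m\end{matrix}\\ \mathbf 0_{n+2m,\,n+2m+1}\end{bmatrix},\qquad B_1=\mathbf 0_{n+2m+1,\,n+m},$$ $$A_2=\begin{bmatrix}\mathbf 0_{1,\,n+m+1}&\mathbf 0_m\\ \mathbf 0_{m,\,n+m+1}&-\operatorname{diag}(\alpha_{n+1},\dots,\alpha_{n+m})\\ \mathbf 0_{n+m,\,n+m+1}&\mathbf 0_{n+m,\,m}\end{bmatrix},\qquad B_2=\begin{bmatrix}\mathbf 0_n&\mathbf 0_m\\ \mathbf 0_{m,n}&\operatorname{diag}(\alpha_{n+1},\dots,\alpha_{n+m})\\ \mathbf 0_{n+m,\,n}&\mathbf 0_{n+m,\,m}\end{bmatrix},$$ $$A_3=\begin{bmatrix}\mathbf 0_{m+1,1}&\mathbf 0_{m+1,m}&\mathbf 0_{m+1,n}&\mathbf 0_{m+1,m}\\ (\beta_1,\dots,\beta_n)^\top&\mathbf 0_{n,m}&\operatorname{diag}(\gamma_1,\dots,\gamma_n)&\mathbf 0_{n,m}\\ \mathbf 0_{m,1}&\mathbf 0_{m,m}&\mathbf 0_{m,n}&\mathbf 0_{m,m}\end{bmatrix},\qquad B_3=\begin{bmatrix}\mathbf 0_{m+1,n}&\mathbf 0_{m+1,m}\\ \operatorname{diag}(\kappa_1,\dots,\kappa_n)&\mathbf 0_{n,m}\\ \mathbf 0_{m,n}&\mathbf 0_{m,m}\end{bmatrix},$$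 $$A_4=\begin{bmatrix}\mathbf 0_{n+m+1,1}&\mathbf 0_{n+m+1,m}&\mathbf 0_{n+m+1,n}&\mathbf 0_{n+m+1,m}\\ (\kappa_{n+1},\dots,\kappa_{n+m})^\top&\operatorname{diag}(\beta_{n+1},\dots,\beta_{n+m})&\mathbf 0_{m,n}&\operatorname{diag}(\gamma_{n+1},\dots,\gamma_{n+m})\end{bmatrix},\qquad B_4=\mathbf 0_{n+2m+1,\,n+m},$$ $$C=\begin{bmatrix}\mathbf 0_{n+m}^\top&I_{n+m}&\mathbf 0_{n+m,m}\end{bmatrix},$$ with $$a=\alpha_1\left(\sum_{j=1}^n\prod_{\substack{i=1\\i\ne j}}^n\alpha_i\right)^{-1}\prod_{i=2}^n\alpha_i.$$
   Context: For pipe $P_j$, $p_{j,\ell},p_{j,r}$ are the deviations from nominal of the pressures at its left and right ends, and $q_{j,\ell},q_{j,r}$ the deviations from nominal of the mass flows at its left and right ends, all functions of time. The constants are $\alpha_j=-\frac{R_sT_0z_0}{A_jX_j}$, $\beta_j=-\frac{A_j}{X_j}$, $\kappa_j=\frac{A_j}{X_j}+\frac{\lambda_j R_sT_0z_0}{2D_jA_j}\frac{\bar q_j|\bar q_j|}{\bar p_{j,\ell}^2}-\frac{A_jgh_j}{R_sT_0z_0X_j}$, $\gamma_j=-\frac{\lambda_j R_sT_0z_0}{D_jA_j}\frac{|\bar q_j|}{\bar p_{j,\ell}}$. Here $R_s$ is the specific gas constant, $T_0$ the constant temperature, $z_0$ the constant compressibility factor and $g$ the gravity constant; for pipe $P_j$,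 $A_j$ is the cross-sectional area (a scalar, not to be confused with the matrices $A_1,\dots,A_4$ of the claim), $X_j$ the length, $D_j$ the inside diameter, $h_j$ the elevation, $\lambda_j$ the friction factor, and $\bar q_j,\bar p_{j,\ell}$ the nominal mass flow and nominal left pressure. Modeling assumptions: the temperature change along each pipe is negligible; each pipe segment has constant cross-sectional area; averaged velocities suffice at each point of the spatial dimension; friction is approximated by the Darcy-Weisbach equation; the compressibility factor is constant along the pipe; capillary, magnetic and electrical forces on the fluid are negligible; the gas velocity is much smaller than the speed of sound. Notation: $\mathbf 0_k$ and $\mathbf 1_k$ are the row vectors of zeros and of ones of length $k$; $\mathbf 0_{k,l}$ is the $k\times l$ zero matrix; $I_k$ is the identity matrix; empty products equal $1$.
   Formalization: The x_i cannot each equal the listed vector (it would be constant and y would be 4Cx). Instead the sum x_1+x_2+x_3+x_4 is the listed vector and each system reads dx_i/dt = A_i(x_1+x_2+x_3+x_4)+B_i u; physical constants, areas, lengths, diameters and nominal pressures are positive. *)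

(* Defs.v *)
(* MathComp + MathComp-Analysis *)
From HB Require Import structures.
From mathcomp Require Import all_boot all_order all_algebra.
From mathcomp Require Import all_classical all_reals all_analysis.
Import Order.TTheory GRing.Theory Num.Theory.
Import numFieldNormedType.Exports.

Set Implicit Arguments.
Unset Strict Implicit.
Unset Printing Implicit Defensive.

Local Open Scope classical_set_scope.
Local Open Scope ring_scope.

Record gas (R : realType) := Gas {
  gas_Rs : R;    (* specific gas constant *)
  gas_T0 : R;    (* temperature *)
  gas_z0 : R;    (* compressibility factor *)
  gas_g : R      (* gravity constant *)
}.

Record pipe (R : realType) := Pipe {
  area : R;
  len : R;
  diam : R;
  elev : R;
  fric : R;
  qnom : R;      (* nominal mass flow *)
  pnom : R       (* nominal pressure at the left end *)
}.

Definition gas_physical (R : realType) (c : gas R) : Prop :=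
  [/\ 0 < gas_Rs c, 0 < gas_T0 c & 0 < gas_z0 c].

(* The flow [qnom], the elevation [elev] and the friction factor [fric] are
   left unconstrained. *)
Definition pipe_physical (R : realType) (P : pipe R) : Prop :=
  [/\ 0 < area P, 0 < len P, 0 < diam P & 0 < pnom P].

Section Coefficients.
Context {R : realType} (c : gas R) (P : pipe R).

Let RTz : R := gas_Rs c * gas_T0 c * gas_z0 c.

Definition alpha : R := - (RTz / (area P * len P)).

Definition beta : R := - (area P / len P).

Definition kappa : R :=
  area P / len P
  + (fric P * RTz) / (2 * diam P * area P)
      * ((qnom P * `|qnom P|) / (pnom P) ^+ 2)
  - (area P * gas_g c * elev P) / (RTz * len P).

Definition gamma : R :=
  - ((fric P * RTz) / (diam P * area P) * (`|qnom P| / pnom P)).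

End Coefficients.

(* Deviations from nominal at the two ends of a pipe, as functions of time. *)
Record pipe_traj (R : realType) := PipeTraj {
  p_l : R -> R;
  p_r : R -> R;
  q_l : R -> R;
  q_r : R -> R
}.

(* Differential equations are required at every time in [T], which is an open
   set of times (an open interval, or the whole line). *)
Definition pipe_dynamics (R : realType) (T : set R) (c : gas R) (P : pipe R)
    (w : pipe_traj R) : Prop :=
  forall t : R, T t ->
    is_derive t 1 (p_r w) (alpha c P * (q_r w t - q_l w t)) /\
    is_derive t 1 (q_l w)
      (beta P * p_r w t + kappa c P * p_l w t + gamma c P * q_l w t).

Section StarJunction.
Context {R : realType} {n m : nat}.

(* Pipes are indexed by 'I_(n + m): P_1, .., P_n are the [inn i] with i : 'I_n,
   and P_(n+1), .., P_(n+m) are the [out k] with k : 'I_m. *)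
Definition inn (i : 'I_n) : 'I_(n + m) := lshift m i.
Definition out (k : 'I_m) : 'I_(n + m) := rshift n k.

Definition matching (w : 'I_(n + m) -> pipe_traj R) (t : R) : Prop :=
  [/\ forall i i' : 'I_n, p_r (w (inn i)) t = p_r (w (inn i')) t,
      forall (i : 'I_n) (k : 'I_m), p_r (w (inn i)) t = p_l (w (out k)) t
    & \sum_(i < n) q_r (w (inn i)) t = \sum_(k < m) q_l (w (out k)) t].

Definition star_junction (T : set R) (c : gas R) (P : 'I_(n + m) -> pipe R)
    (w : 'I_(n + m) -> pipe_traj R) : Prop :=
  (forall j, pipe_dynamics T c (P j) (w j)) /\
  (forall t, T t -> matching w t).

(* State space of dimension n + 2m + 1, in blocks
   p_(1,r) | p_(n+1,r) .. p_(n+m,r) | q_(1,l) .. q_(n,l) |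
   q_(n+1,l) .. q_(n+m,l),
   the two middle blocks being grouped since together they form the output. *)
Definition xdim : nat := 1 + ((m + n) + m).

Definition star_output (w : 'I_(n + m) -> pipe_traj R) (t : R) : 'cV[R]_(m + n) :=
  col_mx (\col_k p_r (w (out k)) t) (\col_i q_l (w (inn i)) t).

Definition star_input (w : 'I_(n + m) -> pipe_traj R) (t : R) : 'cV[R]_(n + m) :=
  col_mx (\col_i p_l (w (inn i)) t) (\col_k q_r (w (out k)) t).

Definition star_state (hn : (0 < n)%N) (w : 'I_(n + m) -> pipe_traj R) (t : R) :
    'cV[R]_xdim :=
  col_mx (p_r (w (inn (Ordinal hn))) t)%:M
    (col_mx (col_mx (\col_k p_r (w (out k)) t) (\col_i q_l (w (inn i)) t))
            (\col_k q_l (w (out k)) t)).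

Section Matrices.
Variables (hn : (0 < n)%N) (c : gas R) (P : 'I_(n + m) -> pipe R).

(* The index [Ordinal hn] is that of P_1, and [0 < i] excludes it. *)
Definition coef_a : R :=
  alpha c (P (inn (Ordinal hn)))
  * (\sum_(j < n) \prod_(i < n | i != j) alpha c (P (inn i)))^-1
  * \prod_(i < n | (0 < i)%N) alpha c (P (inn i)).

(* [const_mx (- coef_a)] is the concatenation of -a and -a 1_(n-1). *)
Definition A1 : 'M[R]_xdim :=
  col_mx (row_mx (0 : 'M[R]_(1, 1))
            (row_mx (row_mx (0 : 'M[R]_(1, m)) (const_mx (- coef_a)))
                    (const_mx coef_a)))
         0.

Definition B1 : 'M[R]_(xdim, n + m) := 0.

Definition A2 : 'M[R]_xdim :=
  col_mx 0
    (col_mx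
      (col_mx (row_mx (0 : 'M[R]_(m, 1))
                 (row_mx 0 (- diag_mx (\row_k alpha c (P (out k))))))
              0)
      0).

Definition B2 : 'M[R]_(xdim, n + m) :=
  col_mx 0
    (col_mx
      (col_mx (row_mx 0 (diag_mx (\row_k alpha c (P (out k))))) 0)
      0).

Definition A3 : 'M[R]_xdim :=
  col_mx 0
    (col_mx
      (col_mx 0
        (row_mx (\col_i beta (P (inn i)))
          (row_mx (row_mx 0 (diag_mx (\row_i gamma c (P (inn i))))) 0)))
      0).

Definition B3 : 'M[R]_(xdim, n + m) :=
  col_mx 0
    (col_mx
      (col_mx 0 (row_mx (diag_mx (\row_i kappa c (P (inn i)))) 0))
      0).

Definition A4 : 'M[R]_xdim :=
  col_mx 0
    (col_mx 0
      (row_mx (\col_k kappa c (P (out k)))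
        (row_mx (row_mx (diag_mx (\row_k beta (P (out k)))) 0)
                (diag_mx (\row_k gamma c (P (out k))))))).

Definition B4 : 'M[R]_(xdim, n + m) := 0.

Definition Cmx : 'M[R]_(m + n, xdim) :=
  row_mx (0 : 'cV[R]_(m + n)) (row_mx 1%:M 0).

(* The four systems are superposed in common coordinates: x_i is the
   contribution of the i-th system, which has nonzero dynamics only in its own
   block of rows, and the vector of state variables, which every A_i acts on,
   is x = x_1 + x_2 + x_3 + x_4.  (Each x_i cannot be a copy of x: all
   A_i x + B_i u would then coincide, and the output would be 4 C x.) *)
Definition star_model (T : set R) (x1 x2 x3 x4 : R -> 'cV[R]_xdim)
    (u : R -> 'cV[R]_(n + m)) (y : R -> 'cV[R]_(m + n)) : Prop :=
  forall t : R, T t ->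
    let x := x1 t + x2 t + x3 t + x4 t in
    [/\ is_derive t 1 x1 (A1 *m x + B1 *m u t),
        is_derive t 1 x2 (A2 *m x + B2 *m u t),
        is_derive t 1 x3 (A3 *m x + B3 *m u t),
        is_derive t 1 x4 (A4 *m x + B4 *m u t)
      & y t = Cmx *m x].

End Matrices.

End StarJunction.

Arguments xdim : clear implicits.

(* Main.v *)
(* On the open set T the pressures p_(i,r), i <= n, are one and the same
   function p, so p' / alpha_i = q_(i,r) - q_(i,l) for every i.  Summing over i
   and using the flow balance, p' * sum_i 1 / alpha_i is the total flow leaving
   the junction minus sum_i q_(i,l), and a is the inverse of sum_i 1 / alpha_i
   (all alpha_i are negative).  This is the first row of the model; its other
   rows are the pipe equations themselves.  Conversely the only end values which
   the model does not record are the q_(i,r), and putting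
   q_(i,r) := q_(i,l) + p' / alpha_i satisfies the pressure equations and, by
   the same summation, the flow balance. *)
Require Import Defs.
From HB Require Import structures.
From mathcomp Require Import all_boot all_order all_algebra.
From mathcomp Require Import all_classical all_reals all_analysis.
Import Order.TTheory GRing.Theory Num.Theory.
Import numFieldNormedType.Exports.

Local Open Scope classical_set_scope.
Local Open Scope ring_scope.

(** * Entrywise differentiation of matrix-valued functions *)

Lemma is_derive_mxP (R : realFieldType) (V : normedModType R) (m n : nat)
    (M : V -> 'M[R]_(m, n)) (t v : V) (dM : 'M[R]_(m, n)) :
  is_derive t v M dM <->
  forall i j, is_derive t v (fun s => M s i j) (dM i j).
Proof.
split=> [[drvM <-] i j|drvM].
  by rewrite derive_mx// mxE; apply/derivableP; move/derivable_mxP: drvM; exact.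
have dM' : derivable M t v by apply/derivable_mxP => i j; apply: ex_derive.
apply: DeriveDef => //; apply/matrixP => i j.
by rewrite derive_mx// mxE; apply: derive_val.
Qed.

(** * Block coordinates on the state space *)

Section StateCoordinates.
Context {R : realType} {n m : nat}.
Implicit Type X : 'cV[R]_(xdim n m).

(** Same block layout as [star_state], with blocks given as functions, so that identities and
    derivatives of states reduce to their four blocks. *)
Definition state_vec (p : R) (a : 'I_m -> R) (b : 'I_n -> R) (d : 'I_m -> R) :
    'cV[R]_(xdim n m) :=
  col_mx p%:M (col_mx (col_mx (\col_k a k) (\col_i b i)) (\col_k d k)).

Definition junction_coord X : R := X (lshift (m + n + m) 0) 0.
Definition pout_coord X (k : 'I_m) : R :=
  X (rshift 1 (lshift m (lshift n k))) 0.
Definition qin_coord X (i : 'I_n) : R := X (rshift 1 (lshift m (rshift m i))) 0.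
Definition qout_coord X (k : 'I_m) : R := X (rshift 1 (rshift (m + n) k)) 0.

Lemma junction_coordE p a b d : junction_coord (state_vec p a b d) = p.
Proof. by rewrite /junction_coord col_mxEu mxE eqxx. Qed.

Lemma pout_coordE p a b d k : pout_coord (state_vec p a b d) k = a k.
Proof. by rewrite /pout_coord col_mxEd !col_mxEu mxE. Qed.

Lemma qin_coordE p a b d i : qin_coord (state_vec p a b d) i = b i.
Proof. by rewrite /qin_coord col_mxEd col_mxEu col_mxEd mxE. Qed.

Lemma qout_coordE p a b d k : qout_coord (state_vec p a b d) k = d k.
Proof. by rewrite /qout_coord !col_mxEd mxE. Qed.

Definition coordE := (junction_coordE, pout_coordE, qin_coordE, qout_coordE).

(** Splitting an index along [1 + ((m + n) + m)] reaches exactly these four shapes; entrywise goals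
    can thus be settled block by block. *)
Lemma state_ind (Q : 'I_(xdim n m) -> Prop) :
  Q (lshift (m + n + m) 0) ->
  (forall k, Q (rshift 1 (lshift m (lshift n k)))) ->
  (forall i, Q (rshift 1 (lshift m (rshift m i)))) ->
  (forall k, Q (rshift 1 (rshift (m + n) k))) -> forall i, Q i.
Proof.
move=> Q0 Qa Qb Qd i; case: (split_ordP i) => [j ->|j ->]; first by rewrite ord1.
case: (split_ordP j) => [h ->|h ->//].
by case: (split_ordP h) => h' ->.
Qed.

Lemma state_vecK X :
  state_vec (junction_coord X) (pout_coord X) (qin_coord X) (qout_coord X) = X.
Proof.
apply/colP; apply: state_ind => [|k|i|k].
- exact: junction_coordE.
- exact: pout_coordE.
- exact: qin_coordE.
- exact: qout_coordE.
Qed.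

Lemma state_vecD p a b d p' a' b' d' :
  state_vec p a b d + state_vec p' a' b' d' =
  state_vec (p + p') (a \+ a') (b \+ b') (d \+ d').
Proof.
rewrite /state_vec !add_col_mx -raddfD/=.
by do ![congr col_mx]; apply/colP => i; rewrite !mxE.
Qed.

Lemma is_derive_stateP (X : R -> 'cV[R]_(xdim n m)) (t v : R) p a b d :
  is_derive t v X (state_vec p a b d) <->
  [/\ is_derive t v (fun s => junction_coord (X s)) p,
      forall k, is_derive t v (fun s => pout_coord (X s) k) (a k),
      forall i, is_derive t v (fun s => qin_coord (X s) i) (b i)
    & forall k, is_derive t v (fun s => qout_coord (X s) k) (d k)].
Proof.
split=> [/is_derive_mxP dX|[dp da db dd]].
  split=> [|k|i|k].
  - by have := dX (lshift (m + n + m) 0) 0;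
      rewrite -/(junction_coord (state_vec p a b d)) coordE.
  - by have := dX (rshift 1 (lshift m (lshift n k))) 0;
      rewrite -/(pout_coord (state_vec p a b d) k) coordE.
  - by have := dX (rshift 1 (lshift m (rshift m i))) 0;
      rewrite -/(qin_coord (state_vec p a b d) i) coordE.
  - by have := dX (rshift 1 (rshift (m + n) k)) 0;
      rewrite -/(qout_coord (state_vec p a b d) k) coordE.
apply/is_derive_mxP => + j; rewrite (ord1 j){j}.
apply: state_ind => [|k|i|k].
- by rewrite -/(junction_coord (state_vec p a b d)) coordE.
- by rewrite -/(pout_coord (state_vec p a b d) k) coordE; exact: da.
- by rewrite -/(qin_coord (state_vec p a b d) i) coordE; exact: db.
- by rewrite -/(qout_coord (state_vec p a b d) k) coordE; exact: dd.
Qed.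

Lemma is_derive_state_vec (p : R -> R) (a : R -> 'I_m -> R) (b : R -> 'I_n -> R)
    (d : R -> 'I_m -> R) (t v : R) dp da db dd :
  is_derive t v p dp ->
  (forall k, is_derive t v (a ^~ k) (da k)) ->
  (forall i, is_derive t v (b ^~ i) (db i)) ->
  (forall k, is_derive t v (d ^~ k) (dd k)) ->
  is_derive t v (fun s => state_vec (p s) (a s) (b s) (d s))
    (state_vec dp da db dd).
Proof.
move=> hp ha hb hd; apply/is_derive_stateP; split=> [|k|i|k].
- by under eq_fun do rewrite junction_coordE.
- by under eq_fun do rewrite pout_coordE.
- by under eq_fun do rewrite qin_coordE.
- by under eq_fun do rewrite qout_coordE.
Qed.

End StateCoordinates.

(** * The junction coefficient a and the flow balance *)

Lemma sum_prod_neq (F : fieldType) (I : finType) (f : I -> F) :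
  (forall i, f i != 0) ->
  \sum_j \prod_(i | i != j) f i = \prod_i f i * \sum_j (f j)^-1.
Proof.
move=> f0; rewrite mulr_sumr; apply: eq_bigr => j _.
(* The factor [f j], detached from the full product, cancels against its inverse. *)
by rewrite [in RHS](bigD1 j)//= mulrAC mulfV ?mul1r.
Qed.

Section Coupling.
Context {R : realType} {n m : nat} (hn : (0 < n)%N) (c : gas R).
Variable P : 'I_(n + m) -> pipe R.
Hypotheses (hc : gas_physical c) (hP : forall j, pipe_physical (P j)).

Lemma alpha_lt0 j : alpha c (P j) < 0.
Proof.
case: hc => Rs0 T0 z0; case: (hP j) => A0 X0 _ _.
by rewrite /alpha oppr_lt0 divr_gt0 ?mulr_gt0.
Qed.

(** Since n > 0, the term of P_1 is present and makes the sum strictly negative, hence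
    invertible. *)
Lemma sum_inv_alpha_lt0 : \sum_(i < n) (alpha c (P (inn i)))^-1 < 0.
Proof.
rewrite (bigD1 (Ordinal hn))//= ltr_wnDr ?invr_lt0 ?alpha_lt0//.
by apply: sumr_le0 => i _; rewrite invr_le0 ltW ?alpha_lt0.
Qed.

(** The factor alpha_1 completes the product over i >= 2 to the full product, which cancels the one
    that [sum_prod_neq] extracts from the denominator. *)
Lemma coef_aE : coef_a hn c P = (\sum_(i < n) (alpha c (P (inn i)))^-1)^-1.
Proof.
have al0 (i : 'I_n) : alpha c (P (inn i)) != 0 by rewrite ltr0_neq0 ?alpha_lt0.
have prodE : \prod_(i < n) alpha c (P (inn i)) =
    alpha c (P (inn (Ordinal hn))) * \prod_(i < n | (0 < i)%N) alpha c (P (inn i)).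
  rewrite (bigD1 (Ordinal hn))//=; congr (_ * _).
  by apply: eq_bigl => i; rewrite -val_eqE/= lt0n.
rewrite /coef_a sum_prod_neq// mulrAC -prodE invfM mulrA mulfV ?mul1r//.
exact/prodf_neq0.
Qed.

(** Each equation is divided by its alpha_i before summing. In the application, the flow balance
    identifies the sum of the [qr i] with the total flow leaving the junction. *)
Lemma coupled_derivative (dp : R) (qr ql : 'I_n -> R) :
  (forall i, dp = alpha c (P (inn i)) * (qr i - ql i)) ->
  dp = coef_a hn c P * (\sum_i qr i - \sum_i ql i).
Proof.
move=> dpE; rewrite coef_aE -sumrB.
have -> : \sum_i (qr i - ql i) = (\sum_(i < n) (alpha c (P (inn i)))^-1) * dp.
  rewrite mulr_suml; apply: eq_bigr => i _.
  by rewrite [in RHS](dpE i) mulKf// ltr0_neq0 ?alpha_lt0.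
by rewrite mulKf// ltr0_neq0 ?sum_inv_alpha_lt0.
Qed.

(** Needed for the converse: with [s] the net outflow, the corrections added to the q_(i,l) have
    total exactly [s]. *)
Lemma sum_inv_alpha_coef_a (s : R) :
  \sum_(i < n) coef_a hn c P * s / alpha c (P (inn i)) = s.
Proof.
by rewrite -mulr_sumr mulrAC coef_aE mulVf ?mul1r// ltr0_neq0 ?sum_inv_alpha_lt0.
Qed.

End Coupling.

(** * Action of the system matrices on block vectors *)

Section StarMatrices.
Context {R : realType} {n m : nat} (hn : (0 < n)%N) (c : gas R).
Variable P : 'I_(n + m) -> pipe R.
Variables (p : R) (a : 'I_m -> R) (b : 'I_n -> R) (d : 'I_m -> R).
Variables (pl : 'I_n -> R) (qr : 'I_m -> R).
Let X : 'cV[R]_(xdim n m) := state_vec p a b d.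
Let U : 'cV[R]_(n + m) := col_mx (\col_i pl i) (\col_k qr k).

Lemma mul_A1B1 :
  A1 hn c P *m X + B1 *m U =
  state_vec (coef_a hn c P * (\sum_k d k - \sum_i b i)) (fun=> 0) (fun=> 0)
    (fun=> 0).
Proof.
rewrite mul0mx addr0 /A1 mul_col_mx mul0mx; apply/colP.
(* [A1] has one zero block below its first row, so the other three state blocks are compared entry
   by entry. *)
apply: state_ind => [|k|i|k].
- rewrite /state_vec !col_mxEu !mul_row_col !mul0mx !add0r !mxE eqxx mulr1n.
  rewrite mulrBr addrC !mulr_sumr -sumrN.
  by congr (_ + _); apply: eq_bigr => i _; rewrite !mxE ?mulNr.
- by rewrite col_mxEd mxE /state_vec col_mxEd !col_mxEu mxE.
- by rewrite col_mxEd mxE /state_vec col_mxEd col_mxEu col_mxEd mxE.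
- by rewrite col_mxEd mxE /state_vec !col_mxEd mxE.
Qed.

Lemma mul_A2B2 :
  A2 c P *m X + B2 c P *m U =
  state_vec 0 (fun k => alpha c (P (out k)) * (qr k - d k)) (fun=> 0) (fun=> 0).
Proof.
rewrite /A2 /B2 !mul_col_mx !mul0mx !add_col_mx !mul_row_col !mul0mx !add0r.
rewrite mulNmx !mul_diag_mx /state_vec raddf0.
by do 3?[congr col_mx]; apply/colP => k; rewrite !mxE// mulrBr addrC.
Qed.

Lemma mul_A3B3 :
  A3 c P *m X + B3 c P *m U =
  state_vec 0 (fun=> 0)
    (fun i => beta (P (inn i)) * p + kappa c (P (inn i)) * pl i +
              gamma c (P (inn i)) * b i)
    (fun=> 0).
Proof.
rewrite /A3 /B3 !mul_col_mx !mul0mx !add_col_mx !mul_row_col !mul0mx !add0r ?addr0.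
rewrite !mul_diag_mx mul_mx_scalar /state_vec raddf0.
by do 3?[congr col_mx]; apply/colP => i; rewrite !mxE// addrAC [p * _]mulrC.
Qed.

Lemma mul_A4B4 :
  A4 c P *m X + B4 *m U =
  state_vec 0 (fun=> 0) (fun=> 0)
    (fun k => beta (P (out k)) * a k + kappa c (P (out k)) * p +
              gamma c (P (out k)) * d k).
Proof.
rewrite /A4 !mul_col_mx !mul0mx addr0 !mul_row_col !mul0mx !addr0.
rewrite !mul_diag_mx mul_mx_scalar /state_vec raddf0.
(* The zero block of height m + n is cut in two to match the layout of [state_vec]. *)
rewrite -[X in col_mx _ (col_mx X _) = _]vsubmxK.
by do 3?[congr col_mx]; apply/colP => k; rewrite !mxE// addrCA addrA [p * _]mulrC.
Qed.

Lemma mul_Cmx : Cmx *m X = col_mx (\col_k a k) (\col_i b i).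
Proof. by rewrite /Cmx !mul_row_col !mul0mx mul1mx add0r addr0. Qed.

End StarMatrices.

(** * Passage from junction trajectories to the model and back *)

Section Realization.
Context {R : realType} {n m : nat} (hn : (0 < n)%N) (c : gas R).
Variables (P : 'I_(n + m) -> pipe R) (T : set R).
Hypotheses (hc : gas_physical c) (hP : forall j, pipe_physical (P j)).
Hypothesis hT : open T.

(** Each x_i carries only the block driven by its own system and is zero elsewhere, so the four add
    up to the state. *)
Lemma star_junction_model (w : 'I_(n + m) -> pipe_traj R)
    (x1 := fun t => state_vec (p_r (w (inn (Ordinal hn))) t)
                      (fun=> 0) (fun=> 0) (fun=> 0) : 'cV[R]_(xdim n m))
    (x2 := fun t => state_vec 0 (fun k => p_r (w (out k)) t)
                      (fun=> 0) (fun=> 0) : 'cV[R]_(xdim n m))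
    (x3 := fun t => state_vec 0 (fun=> 0) (fun i => q_l (w (inn i)) t)
                      (fun=> 0) : 'cV[R]_(xdim n m))
    (x4 := fun t => state_vec 0 (fun=> 0) (fun=> 0)
                      (fun k => q_l (w (out k)) t) : 'cV[R]_(xdim n m)) :
  star_junction T c P w ->
  (forall t, star_state hn w t = x1 t + x2 t + x3 t + x4 t) /\
  star_model hn c P T x1 x2 x3 x4 (star_input w) (star_output w).
Proof.
move=> [dyn match_w].
have xE t : star_state hn w t = x1 t + x2 t + x3 t + x4 t.
  rewrite /x1 /x2 /x3 /x4 !state_vecD !(addr0, add0r) /star_state.
  by rewrite /state_vec; do ![congr col_mx]; apply/colP => k;
    rewrite !mxE/= ?(addr0, add0r).
split=> // t Tt x; rewrite /x -xE /star_state /star_input.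
have [pE pkE qE] := match_w t Tt.
split.
- rewrite mul_A1B1; apply: is_derive_state_vec => [|k|i|k]; try exact: is_derive_cst.
  have [dp _] := dyn (inn (Ordinal hn)) t Tt.
  apply: (is_derive_eq dp); rewrite -qE; apply: coupled_derivative => // i.
  have [di _] := dyn (inn i) t Tt.
  (* Pipe i governs its own [p_r], known to agree with that of P_1 only on [T]. As [T] is open, they
     agree near t, so the derivative carries over, and uniqueness of derivatives equates the two
     values. *)
  suff dpi : is_derive t 1 (p_r (w (inn (Ordinal hn))))
      (alpha c (P (inn i)) * (q_r (w (inn i)) t - q_l (w (inn i)) t)).
    by case: dp => _ <-; case: dpi => _ <-.
  apply: near_eq_is_derive di; near=> s.
  have /match_w [+ _ _] : T s by near: s; exact: open_nbhs_nbhs.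
  exact.
- rewrite mul_A2B2; apply: is_derive_state_vec => [k|i|k]; try exact: is_derive_cst.
  by have [] := dyn (out k) t Tt.
- rewrite mul_A3B3; apply: is_derive_state_vec => [k|i|k]; try exact: is_derive_cst.
  have [_ dq] := dyn (inn i) t Tt.
  by apply: (is_derive_eq dq); rewrite (pE i (Ordinal hn)).
- rewrite mul_A4B4; apply: is_derive_state_vec => [k|i|k]; try exact: is_derive_cst.
  have [_ dq] := dyn (out k) t Tt.
  by apply: (is_derive_eq dq); rewrite -(pkE (Ordinal hn) k).
- by rewrite mul_Cmx.
Unshelve. all: by end_near.
Qed.

(** In [q_r], the derivative of the junction pressure is replaced by its value from the first row of
    the model, which makes [q_r] algebraic in the state. *)
Definition realizing_inn (x : R -> 'cV[R]_(xdim n m)) (u : R -> 'cV[R]_(n + m))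
    (i : 'I_n) : pipe_traj R :=
  PipeTraj (fun t => u t (lshift m i) 0)
    (fun t => junction_coord (x t))
    (fun t => qin_coord (x t) i)
    (fun t => qin_coord (x t) i +
      coef_a hn c P *
        (\sum_k qout_coord (x t) k - \sum_i' qin_coord (x t) i') /
        alpha c (P (inn i))).

Definition realizing_out (x : R -> 'cV[R]_(xdim n m)) (u : R -> 'cV[R]_(n + m))
    (k : 'I_m) : pipe_traj R :=
  PipeTraj (fun t => junction_coord (x t))
    (fun t => pout_coord (x t) k)
    (fun t => qout_coord (x t) k)
    (fun t => u t (rshift n k) 0).

Definition realizing_traj (x : R -> 'cV[R]_(xdim n m)) (u : R -> 'cV[R]_(n + m))
    (j : 'I_(n + m)) : pipe_traj R :=
  match fintype.split j with
  | inl i => realizing_inn x u i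
  | inr k => realizing_out x u k
  end.

Lemma realizing_traj_inn x u i : realizing_traj x u (inn i) = realizing_inn x u i.
Proof. by rewrite /realizing_traj (unsplitK (inl i)). Qed.

Lemma realizing_traj_out x u k : realizing_traj x u (out k) = realizing_out x u k.
Proof. by rewrite /realizing_traj (unsplitK (inr k)). Qed.

(** Adding the four systems gives one equation for the sum [x], whose coordinates yield the pipe
    equations, however [x] is split into the x_i. *)
Lemma star_model_junction x1 x2 x3 x4 u y
    (x := fun t => x1 t + x2 t + x3 t + x4 t) (w := realizing_traj x u) :
  star_model hn c P T x1 x2 x3 x4 u y ->
  star_junction T c P w /\
  forall t, T t ->
    [/\ x t = star_state hn w t, u t = star_input w t & y t = star_output w t].
Proof.
move=> model.
have wi i : w (inn i) = realizing_inn x u i := realizing_traj_inn x u i.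
have wo k : w (out k) = realizing_out x u k := realizing_traj_out x u k.
have uE t : u t = col_mx (\col_i u t (lshift m i) 0) (\col_k u t (rshift n k) 0).
  by rewrite -[LHS]vsubmxK; congr col_mx; apply/colP => i; rewrite !mxE.
(* Each of the four right-hand sides is supported in its own block, so their sum juxtaposes the
   blocks. *)
have dx t : T t -> is_derive t 1 x (state_vec
    (coef_a hn c P *
      (\sum_k qout_coord (x t) k - \sum_i qin_coord (x t) i))
    (fun k => alpha c (P (out k)) * (u t (rshift n k) 0 - qout_coord (x t) k))
    (fun i => beta (P (inn i)) * junction_coord (x t) +
       kappa c (P (inn i)) * u t (lshift m i) 0 +
       gamma c (P (inn i)) * qin_coord (x t) i)
    (fun k => beta (P (out k)) * pout_coord (x t) k +
       kappa c (P (out k)) * junction_coord (x t) +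
       gamma c (P (out k)) * qout_coord (x t) k)).
  move=> /model[]; rewrite -/(x t) uE -[x t]state_vecK.
  rewrite mul_A1B1 mul_A2B2 mul_A3B3 mul_A4B4 => d1 d2 d3 d4 _.
  rewrite state_vecK -uE.
  apply: (is_derive_eq (is_deriveD (is_deriveD (is_deriveD d1 d2) d3) d4)).
  rewrite !state_vecD.
  by congr state_vec; rewrite ?(addr0, add0r)//; apply: funext => k/=;
    rewrite ?(addr0, add0r).
split; first split.
- move=> j t /dx/is_derive_stateP [dp da db dd].
  case: (split_ordP j) => [i ->|k ->].
  + rewrite -/(inn i) wi/=; split; last exact: db.
    apply: (is_derive_eq dp).
    by rewrite addrAC subrr add0r [RHS]mulrC divfK// ltr0_neq0 ?alpha_lt0.
  + by rewrite -/(out k) wo/=; split; [exact: da|exact: dd].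
- move=> t Tt; split=> [i i'|i k|]; rewrite ?wi ?wo//.
  (* The pressure conditions hold by construction, all these pressures being [junction_coord]. In
     the flow balance, the corrections sum to the total outflow minus the total of the q_(i,l). *)
  under eq_bigr do rewrite wi/=.
  under [in RHS]eq_bigr do rewrite wo/=.
  by rewrite big_split/= sum_inv_alpha_coef_a// addrC subrK.
- move=> t Tt; split.
  + rewrite -[LHS]state_vecK /star_state/= wi/= /state_vec.
    by do ![congr col_mx]; apply/colP => k; rewrite !mxE ?wi ?wo.
  + rewrite [LHS]uE /star_input.
    by congr col_mx; apply/colP => k; rewrite !mxE ?wi ?wo.
  + have [_ _ _ _ ->] := model t Tt; rewrite -/(x t) -[x t]state_vecK mul_Cmx.
    by congr col_mx; apply/colP => k; rewrite !mxE ?wi ?wo.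
Qed.

End Realization.

Theorem mainTheorem4 (R : realType) (n m : nat) (hn : (0 < n)%N)
    (c : gas R) (P : 'I_(n + m) -> pipe R)
    (hc : gas_physical c) (hP : forall j : 'I_(n + m), pipe_physical (P j))
    (T : set R) (hT : open T)
    (x : R -> 'cV[R]_(xdim n m)) (u : R -> 'cV[R]_(n + m))
    (y : R -> 'cV[R]_(m + n)) :
  (exists w : 'I_(n + m) -> pipe_traj R,
      star_junction T c P w /\
      forall t : R, T t ->
        [/\ x t = star_state hn w t, u t = star_input w t
          & y t = star_output w t])
  <->
  (exists x1 x2 x3 x4 : R -> 'cV[R]_(xdim n m),
      (forall t : R, T t -> x t = x1 t + x2 t + x3 t + x4 t) /\
      star_model hn c P T x1 x2 x3 x4 u y).
Proof.
split=> [[w [jw xuyE]]|[x1 [x2 [x3 [x4 [xE model]]]]]].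
  have [xE model] := star_junction_model hn c P T hc hP hT w jw.
  do 4 eexists; split=> [t Tt|t Tt].
    by have [-> _ _] := xuyE t Tt; exact: xE.
  (* [star_model] involves [u] and [y] only through their values at [t], so agreement on [T]
     suffices. *)
  by have [_ -> ->] := xuyE t Tt; exact: model.
have [jw wE] := star_model_junction hn c P T hc hP x1 x2 x3 x4 u y model.
(* The trajectory is built from the sum, whose derivative the model prescribes; [x] is only assumed
   to equal it on [T]. *)
by exists (realizing_traj hn c P (fun t => x1 t + x2 t + x3 t + x4 t) u);
  split=> // t Tt; rewrite xE//; exact: wE.
Qed.
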